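(* Let $R=R^\top\succ0$, $Q=Q^\top\succeq0$, $(A,B)$ controllable and $w^{(0)}=0$, i.e. $H^{(0)}=0$. Then iterating between the policy evaluation and the policy improvement steps yields $H^{(i)}\to H$, i.e. $w^{(i)}\to w^*$, as well as $L^{(i)}\to L^*$ as $i\to\infty$.
   Context: System $x_{j+1}=Ax_j+Bu_j$, $x_j\in\mathbb{R}^n$, $u_j\in\mathbb{R}^m$; one-step cost $c_j=\tfrac12\big((x_j-r_j)^\top Q(x_j-r_j)+u_j^\top Ru_j\big)$, discount $\gamma\in[0,1)$; at each time $k$ a reference $r_k,\dots,r_{k+N}\in\mathbb{R}^n$ is given on a moving horizon $N$, with $r_i=0$ for $i>k+N$. The target: minimize $J_k=\sum_{i=k}^\infty\gamma^{i-k}c_i$. The reference-dependent Q-function $Q_0$ (limit $K\to\infty$ of the finite-horizon function defined by ${}^{K}Q_K=c_{k+K}$, ${}^{K}Q_\kappa=c_{k+\kappa}+\gamma\,{}^{K}Q_{\kappa+1}|_{u^*_{k+\kappa+1}}$ with optimal subsequent controls) satisfies $Q_0=\tfrac12 z_k^\top Hz_k$, $z_k=[x_k^\top,u_k^\top,r_k^\top,\dots,r_{k+N}^\top]^\top$, for a structured symmetric matrix $H$ partitioned into blocks $h_{ab}$, $a,b\in\{x,u,r_0,\dots,r_N\}$; $L^*=L(H)$ is the optimal gain, where $L(H)=-h_{uu}^{-1}[h_{ux},h_{ur_1},\dots,h_{ur_N}]$ (and $L(0):=0$), so that $u_k^*=L^*[x_k^\top,r_{k+1}^\top,\dots,r_{k+N}^\top]^\top$.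 Let $\phi$ be the vector of $L$ quadratic basis functions $z_az_b$ ($a\ne b$), $\tfrac12z_a^2$ indexed by the non-redundant (not identically zero, upper-triangular) entries of $H$, and $v(\cdot)$ map such a symmetric matrix to the weight vector $w$ with $w^\top\phi(z)=\tfrac12 z^\top Hz$; $w^*=v(H)$ and $H^{(i)}$ is defined by $v(H^{(i)})=w^{(i)}$. Value iteration at fixed time $k$: using $M_s\ge L$ samples $z_j=[x_j^\top,u_j^\top,r_j^\top,\dots,r_{j+N}^\top]^\top$, $j=k-M_s+1,\dots,k$, with costs $c_j$, and $z^{*(i)}_{j+1}=[x_{j+1}^\top,(L^{(i)}[x_{j+1}^\top,r_{j+2}^\top,\dots,r_{j+N}^\top,0^\top]^\top)^\top,r_{j+1}^\top,\dots,r_{j+N}^\top,0^\top]^\top$, and $\Phi=[\phi(z_{k-M_s+1}),\dots,\phi(z_k)]^\top$ satisfying $\operatorname{rank}(\Phi^\top\Phi)=L$: policy evaluation $w^{(i+1)}=\arg\min_w\sum_j\big(c_j+\gamma(w^{(i)})^\top\phi(z^{*(i)}_{j+1})-w^\top\phi(z_j)\big)^2=(\Phi^\top\Phi)^{-1}\Phi^\top c$; policy improvement $L^{(i+1)}=L(H^{(i+1)})$; initialization $w^{(0)}=0$, $L^{(0)}=0$. *)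

(* Defs.v *)
From HB Require Import structures.
From mathcomp Require Import all_boot all_order all_algebra.
From mathcomp Require Import all_classical all_reals all_analysis.
Set Implicit Arguments. Unset Strict Implicit. Unset Printing Implicit Defensive.
Import Order.TTheory GRing.Theory Num.Theory numFieldNormedType.Exports.
Local Open Scope ring_scope.
Local Open Scope classical_set_scope.

Section LQT.
Variable R : realType.

Definition qform k (M : 'M[R]_k) (v : 'cV[R]_k) : R := (v^T *m M *m v) 0 0.

Definition posdef k (M : 'M[R]_k) : Prop :=
  M^T = M /\ forall v : 'cV[R]_k, v != 0 -> 0 < qform M v.
Definition possemidef k (M : 'M[R]_k) : Prop :=
  M^T = M /\ forall v : 'cV[R]_k, 0 <= qform M v.

Definition controllable n m (A : 'M[R]_n) (B : 'M[R]_(n, m)) : Prop :=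
  \rank (\mxrow_(i < n) (A ^+ i *m B)) = n.

Variables (n m N : nat).

(** dimension of z = [x; u; r_0; ...; r_N] *)
Definition zdim := (n + (m + N.+1 * n))%N.
(** dimension of the gain input [x; r_1; ...; r_N] *)
Definition ydim := (n + N * n)%N.

(** A reference block r_0..r_N is stored as the matrix whose i-th row is r_i^T *)
Definition zvec (x : 'cV[R]_n) (u : 'cV[R]_m) (rs : 'M[R]_(N.+1, n)) : 'cV[R]_zdim :=
  col_mx x (col_mx u (mxvec rs)^T).

Definition ytail (rs : 'M[R]_(N.+1, n)) : 'M[R]_(N, n) :=
  \matrix_(i < N, j < n) rs (lift ord0 i) j.

Definition yvec (x : 'cV[R]_n) (rs : 'M[R]_(N.+1, n)) : 'cV[R]_ydim :=
  col_mx x (mxvec (ytail rs))^T.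

Definition cost (Q : 'M[R]_n) (Rw : 'M[R]_m) (x : 'cV[R]_n) (u : 'cV[R]_m)
  (r : 'cV[R]_n) : R := 2^-1 * (qform Q (x - r) + qform Rw u).

Definition rshiftref (rs : 'M[R]_(N.+1, n)) : 'M[R]_(N.+1, n) :=
  \matrix_(i < N.+1, j < n) (if (i < N)%N then rs (inord i.+1) j else 0).

Fixpoint Qfin (A : 'M[R]_n) (B : 'M[R]_(n, m)) (Q : 'M[R]_n) (Rw : 'M[R]_m)
  (gamma : R) (K : nat) (x : 'cV[R]_n) (u : 'cV[R]_m) (rs : 'M[R]_(N.+1, n)) : R :=
  match K with
  | 0 => cost Q Rw x u (row 0 rs)^T
  | K'.+1 => cost Q Rw x u (row 0 rs)^T +
      gamma * inf (range (fun u' : 'cV[R]_m =>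
                     Qfin A B Q Rw gamma K' (A *m x + B *m u) u' (rshiftref rs)))
  end.

(** block labels of the entries of z: 0 = x, 1 = u, i.+2 = r_i *)
Definition idx_pair (c : 'I_(N.+1 * n)) : 'I_N.+1 * 'I_n :=
  enum_val (cast_ord (esym (mxvec_cast _ _)) c).

Definition blk (p : 'I_zdim) : nat :=
  match fintype.split p with
  | inl _ => 0%N
  | inr p' => match fintype.split p' with
              | inl _ => 1%N
              | inr p'' => ((idx_pair p'').1).+2
              end
  end.

(** structurally (identically) zero blocks of H: h_{u r_0} and h_{r_0 r_i}, i >= 1 *)
Definition zero_blk (a b : nat) : bool :=
  ((a == 1%N) && (b == 2%N)) || ((a == 2%N) && (b == 1%N)) ||
  ((a == 2%N) && (2 < b)%N) || ((b == 2%N) && (2 < a)%N).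

Definition nonred (p q : 'I_zdim) : bool :=
  (p <= q)%N && ~~ zero_blk (blk p) (blk q).

Definition pairs : seq ('I_zdim * 'I_zdim) :=
  [seq pq <- enum {: 'I_zdim * 'I_zdim} | nonred pq.1 pq.2].

Definition nL := size pairs.
Definition tpairs : nL.-tuple ('I_zdim * 'I_zdim) := in_tuple pairs.

Definition phi (z : 'cV[R]_zdim) : 'cV[R]_nL :=
  \col_(k < nL) let pq := tnth tpairs k in
     if pq.1 == pq.2 then 2^-1 * z pq.1 0 ^+ 2 else z pq.1 0 * z pq.2 0.

(** v(H): weight vector with w^T phi(z) = 1/2 z^T H z *)
Definition vmap (H : 'M[R]_zdim) : 'cV[R]_nL :=
  \col_(k < nL) H (tnth tpairs k).1 (tnth tpairs k).2.

Definition Hof (w : 'cV[R]_nL) : 'M[R]_zdim :=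
  \matrix_(p, q) \sum_(k < nL | (tnth tpairs k == (p, q)) || (tnth tpairs k == (q, p)))
                    w k 0.

Definition ix (b : 'I_n) : 'I_zdim := lshift (m + N.+1 * n) b.
Definition iu (a : 'I_m) : 'I_zdim := rshift n (lshift (N.+1 * n) a).
Definition ir (i : 'I_N.+1) (j : 'I_n) : 'I_zdim :=
  rshift n (rshift m (mxvec_index i j)).

Definition idx_tail (c : 'I_(N * n)) : 'I_N * 'I_n :=
  enum_val (cast_ord (esym (mxvec_cast _ _)) c).

Definition huy (H : 'M[R]_zdim) : 'M[R]_(m, ydim) :=
  \matrix_(a < m, c < ydim)
    match fintype.split c with
    | inl b => H (iu a) (ix b)
    | inr c' => H (iu a) (ir (lift ord0 (idx_tail c').1) (idx_tail c').2)
    end.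

Definition huu (H : 'M[R]_zdim) : 'M[R]_m := \matrix_(a, b) H (iu a) (iu b).

Definition gain (H : 'M[R]_zdim) : 'M[R]_(m, ydim) :=
  if H == 0 then 0 else - (invmx (huu H) *m huy H).

(** data: states x_j, inputs u_j, references r_t; samples j = 0..Ms-1
   (relative indexing of j = k-Ms+1..k). Reference window known at time j:
   r_t for t <= j + N, and 0 beyond. *)
Definition refs_at (r : nat -> 'cV[R]_n) (j t : nat) : 'M[R]_(N.+1, n) :=
  \matrix_(i < N.+1, c < n) (if (t + i <= j + N)%N then r (t + i)%N c 0 else 0).

Definition zsample (x : nat -> 'cV[R]_n) (u : nat -> 'cV[R]_m)
  (r : nat -> 'cV[R]_n) (j : nat) : 'cV[R]_zdim :=
  zvec (x j) (u j) (refs_at r j j).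

Definition zstar (x : nat -> 'cV[R]_n) (r : nat -> 'cV[R]_n)
  (Lg : 'M[R]_(m, ydim)) (j : nat) : 'cV[R]_zdim :=
  let rs := refs_at r j j.+1 in zvec (x j.+1) (Lg *m yvec (x j.+1) rs) rs.

Definition Phi Ms (x : nat -> 'cV[R]_n) (u : nat -> 'cV[R]_m)
  (r : nat -> 'cV[R]_n) : 'M[R]_(Ms, nL) :=
  \matrix_(j < Ms, k < nL) phi (zsample x u r j) k 0.

Definition vi_step Ms (Q : 'M[R]_n) (Rw : 'M[R]_m) (gamma : R)
  (x : nat -> 'cV[R]_n) (u : nat -> 'cV[R]_m) (r : nat -> 'cV[R]_n)
  (w : 'cV[R]_nL) : 'cV[R]_nL :=
  let Ph := Phi Ms x u r in
  let Lg := gain (Hof w) in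
  let target := \col_(j < Ms)
     (cost Q Rw (x j) (u j) (r j) + gamma * (w^T *m phi (zstar x r Lg j)) 0 0) in
  invmx (Ph^T *m Ph) *m Ph^T *m target.

Fixpoint w_iter Ms Q Rw gamma x u r (i : nat) : 'cV[R]_nL :=
  match i with
  | 0 => 0
  | i'.+1 => vi_step Ms Q Rw gamma x u r (w_iter Ms Q Rw gamma x u r i')
  end.

End LQT.

(* Main.v *)
(* With noise-free data and a full-rank regressor the least-squares policy
   evaluation is exact: as [w^T phi(z) = 1/2 z^T H(w) z], the targets
   [c_j + gamma w^T phi(z*_{j+1})] are the quadratic form of the Bellman backup
   of [H(w)], so [H^(i+1)] is that backup.  The greedy gain [L(H^(i))] minimises
   the backup over the next input, hence by induction [1/2 z^T H^(K+1) z] is the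
   finite-horizon Q-function [^K Q_0], which tends to [1/2 z^T H z] by
   hypothesis.  Polarisation turns this into entrywise convergence [H^(i) -> H],
   whence [w^(i) = v(H^(i)) -> v(H)]; finally [h_uu] of the limit dominates
   [R > 0], so it is invertible and [L] is continuous at [H]. *)

Require Import Defs.
From HB Require Import structures.
From mathcomp Require Import all_boot all_order all_algebra.
From mathcomp Require Import all_classical all_reals all_analysis.
From mathcomp Require Import ring lra.
Import Order.TTheory GRing.Theory Num.Theory numFieldNormedType.Exports.
Set Implicit Arguments. Unset Strict Implicit. Unset Printing Implicit Defensive.
Local Open Scope ring_scope.
Local Open Scope classical_set_scope.

Lemma addmxE (R : nmodType) k l (A B : 'M[R]_(k, l)) i j :
  (A + B) i j = A i j + B i j.
Proof. by rewrite mxE. Qed.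

Lemma mx0E (R : nmodType) k l i j : (0 : 'M[R]_(k, l)) i j = 0.
Proof. by rewrite mxE. Qed.

Lemma oppmxE (R : zmodType) k l (A : 'M[R]_(k, l)) i j : (- A) i j = - A i j.
Proof. by rewrite mxE. Qed.

Lemma scalemxE (R : pzRingType) k l c (A : 'M[R]_(k, l)) i j :
  (c *: A) i j = c * A i j.
Proof. by rewrite mxE. Qed.

Section quadratic_forms.
Variables (R : realType) (k : nat).
Implicit Types (G S : 'M[R]_k) (v z : 'cV[R]_k).
Local Notation e_ p := (delta_mx p 0 : 'cV[R]_k).

Lemma bilinE G v z : (v^T *m G *m z) 0 0 = \sum_p \sum_q v p 0 * G p q * z q 0.
Proof.
rewrite mxE exchange_big /=; apply: eq_bigr => q _.
by rewrite mxE big_distrl /=; apply: eq_bigr => p _; rewrite mxE.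
Qed.

Lemma qformE G z : qform G z = \sum_p \sum_q z p 0 * G p q * z q 0.
Proof. exact: bilinE. Qed.

Lemma qform0l z : qform 0 z = 0.
Proof. by rewrite /qform mulmx0 mul0mx mxE. Qed.

Lemma qform0r G : qform G 0 = 0.
Proof. by rewrite /qform mulmx0 mxE. Qed.

Lemma qformDl G1 G2 z : qform (G1 + G2) z = qform G1 z + qform G2 z.
Proof. by rewrite /qform mulmxDr mulmxDl mxE. Qed.

Lemma qformZl c G z : qform (c *: G) z = c * qform G z.
Proof. by rewrite /qform -scalemxAr -scalemxAl mxE. Qed.

Lemma qform_mulmx l (G : 'M[R]_l) (P : 'M[R]_(l, k)) z :
  qform G (P *m z) = qform (P^T *m G *m P) z.
Proof. by rewrite /qform trmx_mul !mulmxA. Qed.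

Lemma bilinC S v z : S^T = S -> (v^T *m S *m z) 0 0 = (z^T *m S *m v) 0 0.
Proof.
move=> sS; transitivity ((v^T *m S *m z)^T 0 0); first by rewrite [RHS]mxE.
by rewrite !trmx_mul trmxK sS mulmxA.
Qed.

Lemma qformDr S v z : S^T = S ->
  qform S (v + z) = qform S v + 2 * (z^T *m S *m v) 0 0 + qform S z.
Proof.
move=> sS; rewrite /qform !linearD /= !mulmxDl !addmxE (bilinC v z sS); lra.
Qed.

Lemma bilin_delta S (p q : 'I_k) : ((e_ q)^T *m S *m e_ p) 0 0 = S q p.
Proof. by rewrite trmx_delta -mulmxA -colE -rowE !mxE. Qed.

Lemma qform_polar S (p q : 'I_k) : S^T = S ->
  S p q = 2^-1 * (qform S (e_ p + e_ q) - qform S (e_ p) - qform S (e_ q)).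
Proof.
move=> sS; rewrite qformDr // bilin_delta.
have -> : S q p = S p q by rewrite -[in LHS]sS mxE.
lra.
Qed.

Lemma qform_inj S1 S2 : S1^T = S1 -> S2^T = S2 ->
  (forall z, qform S1 z = qform S2 z) -> S1 = S2.
Proof.
move=> sS1 sS2 eqS; apply/matrixP => p q.
by rewrite qform_polar // [RHS]qform_polar // !eqS.
Qed.

Lemma sum_sym_upper (a : 'I_k -> 'I_k -> R) : (forall p q, a p q = a q p) ->
  \sum_p \sum_q a p q =
  \sum_(p < k) \sum_(q < k | (p <= q)%N) (if p == q then 1 else 2) * a p q.
Proof.
move=> aC; pose U (p q : 'I_k) := if (p < q)%N then a p q else 0.
pose D (p q : 'I_k) := if p == q then a p q else 0.
have split_a p q : a p q = U p q + U q p + D p q.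
  by rewrite /U /D -val_eqE /=; case: ltngtP => [||/val_inj->];
    rewrite ?addr0 ?add0r // aC.
have -> : \sum_p \sum_q a p q =
    \sum_p \sum_q U p q + \sum_p \sum_q U q p + \sum_p \sum_q D p q.
  rewrite -!big_split; apply: eq_bigr => p _.
  by rewrite -!big_split; apply: eq_bigr => q _.
rewrite [X in _ + X + _]exchange_big -!big_split; apply: eq_bigr => p _.
rewrite -!big_split [RHS]big_mkcond; apply: eq_bigr => q _ /=.
rewrite /U /D -val_eqE /= [(p <= q)%N]leq_eqVlt.
case: (ltngtP p q) => [||/val_inj->] /=.
- by move=> _; rewrite addr0 mulr2n; ring.
- by rewrite !addr0.
- by rewrite mul1r !add0r.
Qed.

Lemma qform_upper S z : S^T = S ->
  2^-1 * qform S z = \sum_(p < k) \sum_(q < k | (p <= q)%N)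
     S p q * (if p == q then 2^-1 * z p 0 ^+ 2 else z p 0 * z q 0).
Proof.
move=> sS; rewrite qformE sum_sym_upper => [|p q]; last first.
  by rewrite -[in RHS]sS mxE; ring.
rewrite mulr_sumr; apply: eq_bigr => p _; rewrite mulr_sumr; apply: eq_bigr => q _.
by case: eqP => [->|_]; field.
Qed.

Lemma posdef_unitmx S : (forall v, v != 0 -> 0 < qform S v) -> S \in unitmx.
Proof.
move=> pS; rewrite unitmxE unitfE; apply/det0P => -[v v0 vS].
have /pS : v^T != 0 by rewrite trmx_eq0.
by rewrite /qform trmxK vS mul0mx mxE ltxx.
Qed.

Lemma pos_qform_ge0 S : (forall v, v != 0 -> 0 < qform S v) ->
  forall v, 0 <= qform S v.
Proof. by move=> pS v; have [->|/pS/ltW] := eqVneq v 0; rewrite ?qform0r. Qed.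

Lemma qform_min_affine (U : 'M[R]_k) (h v0 v : 'cV[R]_k) :
  U^T = U -> (forall v, 0 <= qform U v) -> U *m v0 = - h ->
  2 * (v0^T *m h) 0 0 + qform U v0 <= 2 * (v^T *m h) 0 0 + qform U v.
Proof.
move=> sU U0 Uv0.
have hE (y : 'cV[R]_k) : (y^T *m h) 0 0 = - (y^T *m U *m v0) 0 0.
  by rewrite -mulmxA Uv0 mulmxN oppmxE opprK.
have split_v : qform U v =
    qform U (v - v0) + 2 * (v0^T *m U *m (v - v0)) 0 0 + qform U v0.
  by rewrite -qformDr // subrK.
have := U0 (v - v0).
by rewrite !hE split_v mulmxBr addmxE oppmxE (bilinC v0 v sU) /qform; lra.
Qed.

End quadratic_forms.

Section matrix_of_linear_map.
Variables (R : realType) (k l : nat).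
Local Notation e_ j := (delta_mx j 0 : 'cV[R]_k).

(* MathComp's [lin1_mx] is the analogue for row vectors. *)
Definition colmx (f : 'cV[R]_k -> 'cV[R]_l) : 'M[R]_(l, k) :=
  \matrix_(i, j) f (e_ j) i 0.

Lemma mul_colmx (f : 'cV[R]_k -> 'cV[R]_l) : linear f ->
  forall z, colmx f *m z = f z.
Proof.
move=> lf z; have f0 : f 0 = 0.
  by rewrite -(scale0r (0 : 'cV[R]_k)) (scalable_linear lf); exact: scale0r.
have -> : f z = \sum_j z j 0 *: f (e_ j).
  have {1}-> : z = \sum_j z j 0 *: e_ j.
    by rewrite [LHS]matrix_sum_delta; apply: eq_bigr => j _; rewrite big_ord1.
  by apply: (big_rec2 (fun y1 y2 => f y1 = y2)) => // j y1 y2 _ <-; exact: lf.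
apply/matrixP => i c; rewrite (ord1 c) mxE summxE; apply: eq_bigr => j _.
by rewrite !mxE mulrC.
Qed.

Lemma colmx_sandwich (f : 'cV[R]_k -> 'cV[R]_l) (G : 'M[R]_l) (p q : 'I_k) :
  linear f -> f (e_ p) = 0 \/ f (e_ q) = 0 ->
  ((colmx f)^T *m G *m colmx f) p q = 0.
Proof.
move=> lf f0; rewrite -bilin_delta !mulmxA -trmx_mul -!mulmxA !mul_colmx //.
by case: f0 => ->; rewrite ?trmx0 ?mul0mx ?mulmx0 mxE.
Qed.

End matrix_of_linear_map.

Section matrix_limits.
Variables (R : realType) (T : Type) (F : set_system T).
Context {FF : Filter F}.

Lemma cvg_mxP k l (f : T -> 'M[R]_(k, l)) (M : 'M[R]_(k, l)) :
  f @ F --> M <-> forall i j, f t i j @[t --> F] --> M i j.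
Proof.
split=> [fM i j|fM A [P PM PA]].
  exact: (continuous_cvg _ (@coord_continuous R k l i j M) fM).
have PfF : \forall t \near F, forall i j, P i j (f t i j).
  by do 2 apply: filter_forall => ?; exact: fM.
by apply: filterS PfF => t Pft; exact: PA.
Qed.

Lemma cvg_mulmx k l p (f : T -> 'M[R]_(k, l)) (g : T -> 'M[R]_(l, p))
    (M1 : 'M[R]_(k, l)) (M2 : 'M[R]_(l, p)) :
  f @ F --> M1 -> g @ F --> M2 -> f t *m g t @[t --> F] --> M1 *m M2.
Proof.
move=> /cvg_mxP fM /cvg_mxP gM; apply/cvg_mxP => i j.
under eq_cvg do rewrite mxE; rewrite mxE.
by apply: (cvg_big add_continuous) => // c _; exact: cvgM.
Qed.

Lemma cvg_det k (f : T -> 'M[R]_k) (M : 'M[R]_k) :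
  f @ F --> M -> \det (f t) @[t --> F] --> \det M.
Proof.
move=> /cvg_mxP fM; apply: (cvg_big add_continuous) => // s _.
by apply: cvgMl_tmp; apply: (cvg_big mul_continuous) => // i _; exact: fM.
Qed.

Lemma cvg_adj k (f : T -> 'M[R]_k) (M : 'M[R]_k) :
  f @ F --> M -> \adj (f t) @[t --> F] --> \adj M.
Proof.
move=> fM; apply/cvg_mxP => i j; under eq_cvg do rewrite mxE; rewrite mxE.
apply: cvgMl_tmp; apply: cvg_det; apply/cvg_mxP => a b.
under eq_cvg do rewrite !mxE; rewrite !mxE.
by move/cvg_mxP: fM; apply.
Qed.

Lemma cvg_invmx k (f : T -> 'M[R]_k) (M : 'M[R]_k) :
  M \in unitmx -> f @ F --> M -> invmx (f t) @[t --> F] --> invmx M.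
Proof.
move=> uM fM; have detM : \det M != 0 by rewrite -unitfE -unitmxE.
have dfM := cvg_det fM.
have invE : {near F, (fun t => (\det (f t))^-1 *: \adj (f t)) =1 invmx \o f}.
  apply: filterS (cvgr_neq0 _ dfM detM) => t dft /=.
  by rewrite /invmx unitmxE unitfE dft.
apply: cvg_trans (near_eq_cvg invE) _.
rewrite /invmx uM; apply: cvgZ; [exact: cvgV | exact: cvg_adj].
Qed.

Lemma cvg_mx_of_qform k (S : T -> 'M[R]_k) (H : 'M[R]_k) :
  (forall t, (S t)^T = S t) -> H^T = H ->
  (forall z, qform (S t) z @[t --> F] --> qform H z) -> S @ F --> H.
Proof.
move=> sS sH qS; apply/cvg_mxP => p q.
under eq_cvg do rewrite qform_polar //; rewrite qform_polar //.
by apply: cvgMl_tmp; apply: cvgB; [apply: cvgB|]; exact: qS.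
Qed.

End matrix_limits.

Lemma sum_mxvec_index (V : nmodType) (k l : nat) (F : 'I_(k * l) -> V) :
  \sum_c F c = \sum_(i < k) \sum_(j < l) F (mxvec_index i j).
Proof.
rewrite pair_bigA /= (reindex (uncurry (@mxvec_index k l))) /=.
  by apply: eq_bigr => -[i j].
exact: curry_mxvec_bij.
Qed.

Section z_coordinates.
Variables (R : realType) (n m N : nat).
Local Notation zd := (zdim n m N).
Local Notation yd := (ydim n N).
Local Notation ix := (@ix n m N).
Local Notation iu := (@iu n m N).
Local Notation ir := (@ir n m N).
Implicit Types (x : 'cV[R]_n) (u v : 'cV[R]_m) (rs : 'M[R]_(N.+1, n)).

Lemma sum_zdim (F : 'I_zd -> R) :
  \sum_p F p = \sum_b F (ix b) + (\sum_a F (iu a) + \sum_i \sum_j F (ir i j)).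
Proof. by rewrite big_split_ord /= big_split_ord /= sum_mxvec_index. Qed.

Lemma sum_ydim (F : 'I_yd -> R) :
  \sum_c F c = \sum_b F (lshift (N * n) b)
               + \sum_(i < N) \sum_(j < n) F (rshift n (mxvec_index i j)).
Proof. by rewrite big_split_ord /= sum_mxvec_index. Qed.

Lemma zvec_ix x u rs b : zvec x u rs (ix b) 0 = x b 0.
Proof. by rewrite col_mxEu. Qed.

Lemma zvec_iu x u rs a : zvec x u rs (iu a) 0 = u a 0.
Proof. by rewrite col_mxEd col_mxEu. Qed.

Lemma zvec_ir x u rs i j : zvec x u rs (ir i j) 0 = rs i j.
Proof. by rewrite !col_mxEd mxE mxvecE. Qed.

Lemma yvec_lshift x rs b : yvec x rs (lshift (N * n) b) 0 = x b 0.
Proof. by rewrite col_mxEu. Qed.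

Lemma yvec_rshift x rs i j :
  yvec x rs (rshift n (mxvec_index i j)) 0 = rs (lift ord0 i) j.
Proof. by rewrite col_mxEd mxE mxvecE mxE. Qed.

Lemma blk_ix b : blk (ix b) = 0%N.
Proof. by rewrite /blk /ix (unsplitK (inl _ : 'I_n + 'I_(m + N.+1 * n))). Qed.

Lemma blk_iu a : blk (iu a) = 1%N.
Proof.
rewrite /blk /iu (unsplitK (inr _ : 'I_n + 'I_(m + N.+1 * n))).
by rewrite (unsplitK (inl _ : 'I_m + 'I_(N.+1 * n))).
Qed.

Lemma blk_ir i j : blk (ir i j) = i.+2.
Proof.
rewrite /blk /ir (unsplitK (inr _ : 'I_n + 'I_(m + N.+1 * n))).
rewrite (unsplitK (inr _ : 'I_m + 'I_(N.+1 * n))).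
by rewrite /idx_pair /mxvec_index cast_ordK enum_rankK.
Qed.

Lemma huy_lshift (S : 'M[R]_zd) a b : huy S a (lshift (N * n) b) = S (iu a) (ix b).
Proof. by rewrite mxE (unsplitK (inl _ : 'I_n + 'I_(N * n))). Qed.

Lemma huy_rshift (S : 'M[R]_zd) a i j :
  huy S a (rshift n (mxvec_index i j)) = S (iu a) (ir (lift ord0 i) j).
Proof.
rewrite mxE (unsplitK (inr _ : 'I_n + 'I_(N * n))).
by rewrite /idx_tail /mxvec_index cast_ordK enum_rankK.
Qed.

Definition zx (z : 'cV[R]_zd) : 'cV[R]_n := usubmx z.
Definition zu (z : 'cV[R]_zd) : 'cV[R]_m := usubmx (dsubmx z).
Definition zr (z : 'cV[R]_zd) : 'M[R]_(N.+1, n) := vec_mx (dsubmx (dsubmx z))^T.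

Lemma zvecK z : zvec (zx z) (zu z) (zr z) = z.
Proof. by rewrite /zvec /zx /zu /zr vec_mxK trmxK !vsubmxK. Qed.

Lemma zx_zvec x u rs : zx (zvec x u rs) = x.
Proof. by rewrite /zx col_mxKu. Qed.

Lemma zu_zvec x u rs : zu (zvec x u rs) = u.
Proof. by rewrite /zu col_mxKd col_mxKu. Qed.

Lemma zr_zvec x u rs : zr (zvec x u rs) = rs.
Proof. by rewrite /zr !col_mxKd trmxK mxvecK. Qed.

Lemma zxE z b : zx z b 0 = z (ix b) 0.
Proof. by rewrite -{2}(zvecK z) zvec_ix. Qed.

Lemma zuE z a : zu z a 0 = z (iu a) 0.
Proof. by rewrite -{2}(zvecK z) zvec_iu. Qed.

Lemma zrE z i j : zr z i j = z (ir i j) 0.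
Proof. by rewrite -{2}(zvecK z) zvec_ir. Qed.

Lemma zx_linear : linear zx. Proof. by move=> a z1 z2; rewrite /zx linearP. Qed.
Lemma zu_linear : linear zu. Proof. by move=> a z1 z2; rewrite /zu !linearP. Qed.
Lemma zr_linear : linear zr. Proof. by move=> a z1 z2; rewrite /zr !linearP. Qed.

Lemma zvecP a x1 u1 r1 x2 u2 r2 :
  zvec (a *: x1 + x2) (a *: u1 + u2) (a *: r1 + r2) =
  a *: zvec x1 u1 r1 + zvec x2 u2 r2 :> 'cV[R]_zd.
Proof. by rewrite /zvec !linearP /= !scale_col_mx !add_col_mx. Qed.

Lemma zvec_split x u rs : zvec x u rs = zvec x 0 rs + zvec 0 u 0.
Proof. by have := zvecP 1 x 0 rs 0 u 0; rewrite !scale1r !addr0 add0r. Qed.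

Lemma zvec0 : zvec 0 0 0 = 0 :> 'cV[R]_zd.
Proof. by rewrite /zvec linear0 trmx0 !col_mx0. Qed.

Lemma yvecP a x1 r1 x2 r2 :
  yvec (a *: x1 + x2) (a *: r1 + r2) = a *: yvec x1 r1 + yvec x2 r2 :> 'cV[R]_yd.
Proof.
rewrite /yvec; have -> : ytail (a *: r1 + r2) = a *: ytail r1 + ytail r2.
  by apply/matrixP => i j; rewrite !mxE.
by rewrite !linearP /= scale_col_mx add_col_mx.
Qed.

Lemma yvec0 : yvec 0 0 = 0 :> 'cV[R]_yd.
Proof.
rewrite /yvec; have -> : ytail (0 : 'M[R]_(N.+1, n)) = 0.
  by apply/matrixP => i j; rewrite !mxE.
by rewrite linear0 trmx0 col_mx0.
Qed.

Lemma rshiftrefP a r1 r2 :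
  rshiftref (a *: r1 + r2) = a *: rshiftref r1 + rshiftref r2 :> 'M[R]_(N.+1, n).
Proof. by apply/matrixP => i j; rewrite !mxE; case: ifP; rewrite ?mulr0 ?addr0. Qed.

End z_coordinates.

Section weight_representation.
Variables (R : realType) (n m N : nat).
Local Notation zd := (zdim n m N).
Local Notation pair := (tnth (tpairs n m N)).
Implicit Types (G : 'M[R]_zd) (z : 'cV[R]_zd) (w : 'cV[R]_(nL n m N)).

Definition structured G := forall p q, zero_blk (blk p) (blk q) -> G p q = 0.

Lemma zero_blkC a b : zero_blk a b = zero_blk b a.
Proof. by case: a b => [|[|[|a]]] [|[|[|b]]]. Qed.

Lemma pair_nonred k : nonred (pair k).1 (pair k).2.
Proof. by have := mem_tnth k (tpairs n m N); rewrite mem_filter => /andP[]. Qed.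

Lemma pair_inj : injective pair.
Proof. by apply/tuple_uniqP; rewrite filter_uniq // enum_uniq. Qed.

Lemma Hof0 : Hof 0 = 0 :> 'M[R]_zd.
Proof. by apply/matrixP => p q; rewrite !mxE big1 // => k _; rewrite mxE. Qed.

Lemma Hof_sym w : (Hof w)^T = Hof w.
Proof. by apply/matrixP => p q; rewrite !mxE; apply: eq_bigl => k; rewrite orbC. Qed.

Lemma Hof_structured w : structured (Hof w).
Proof.
move=> p q zpq; rewrite mxE big_pred0 // => k; have := pair_nonred k.
rewrite /nonred; case: (pair k) => a b /=; apply: contraTF => /orP[] /eqP[-> ->].
  by rewrite zpq andbF.
by rewrite zero_blkC zpq andbF.
Qed.

Lemma vmap_Hof w : vmap (Hof w) = w.
Proof.
apply/matrixP => k c; rewrite (ord1 c) !mxE (big_pred1 k) // => k'.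
apply/idP/eqP => [|->]; last by rewrite -surjective_pairing eqxx.
have := pair_nonred k; have := pair_nonred k'; rewrite /nonred.
case Ek : (pair k) => [p q]; case Ek' : (pair k') => [p' q'] /=.
move=> /andP[le' _] /andP[le _] /orP[] /eqP[ep eq]; apply: pair_inj.
  by rewrite Ek Ek' ep eq.
have epq : p = q by apply/val_inj/eqP; rewrite eqn_leq le -eq -ep le'.
by rewrite Ek Ek' ep eq epq.
Qed.

Lemma vmap_phi G z : G^T = G -> structured G ->
  ((vmap G)^T *m phi z) 0 0 = 2^-1 * qform G z.
Proof.
move=> sG stG; rewrite qform_upper // mxE.
pose F (pq : 'I_zd * 'I_zd) := G pq.1 pq.2 *
  (if pq.1 == pq.2 then 2^-1 * z pq.1 0 ^+ 2 else z pq.1 0 * z pq.2 0).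
transitivity (\sum_(pq <- pairs n m N) F pq).
  rewrite -[pairs _ _ _]/(val (tpairs n m N)) big_tuple.
  by apply: eq_bigr => k _; rewrite !mxE.
rewrite big_filter big_enum_cond /=.
rewrite -(pair_big_dep xpredT (@nonred n m N) (fun p q => F (p, q))) /=.
apply: eq_bigr => p _; rewrite big_mkcond [RHS]big_mkcond; apply: eq_bigr => q _ /=.
rewrite /nonred; case: (p <= q)%N => //=; case: (boolP (zero_blk _ _)) => //= zpq.
by rewrite /F /= stG ?mul0r.
Qed.

Lemma Hof_phi w z : (w^T *m phi z) 0 0 = 2^-1 * qform (Hof w) z.
Proof.
by rewrite -{1}(vmap_Hof w) vmap_phi //; [exact: Hof_sym | exact: Hof_structured].
Qed.

Lemma Hof_vmap G : G^T = G -> structured G -> Hof (vmap G) = G.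
Proof.
move=> sG stG; apply: qform_inj => [||z]; [exact: Hof_sym | exact: sG |].
by have := Hof_phi (vmap G) z; rewrite vmap_phi //; lra.
Qed.

End weight_representation.

Lemma mulmx_lsq_exact (R : realType) k l (P : 'M[R]_(k, l)) (w : 'cV[R]_l) :
  P^T *m P \in unitmx -> invmx (P^T *m P) *m P^T *m (P *m w) = w.
Proof. by move=> uP; rewrite -mulmxA (mulmxA P^T) mulKmx. Qed.

Section bellman_matrix.
Variables (R : realType) (n m N : nat).
Variables (A : 'M[R]_n) (B : 'M[R]_(n, m)) (Q : 'M[R]_n) (Rw : 'M[R]_m) (gamma : R).
Local Notation zd := (zdim n m N).
Implicit Types (S : 'M[R]_zd) (z : 'cV[R]_zd).

Definition track_err z : 'cV[R]_n := zx z - (row 0 (zr z))^T.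

Definition next_z S z : 'cV[R]_zd :=
  let x' := A *m zx z + B *m zu z in
  let rs' := rshiftref (zr z) in
  zvec x' (gain S *m yvec x' rs') rs'.

Definition bellman_mx S : 'M[R]_zd :=
  (colmx track_err)^T *m Q *m colmx track_err
  + (colmx (@zu R n m N))^T *m Rw *m colmx (@zu R n m N)
  + gamma *: ((colmx (next_z S))^T *m S *m colmx (next_z S)).

Lemma track_err_linear : linear track_err.
Proof.
move=> a z1 z2; rewrite /track_err zx_linear zr_linear.
have -> : row 0 (a *: zr z1 + zr z2) = a *: row 0 (zr z1) + row 0 (zr z2).
  by apply/matrixP => i j; rewrite !mxE.
by rewrite linearD linearZ /= scalerBr opprD addrACA.
Qed.

Lemma next_z_linear S : linear (next_z S).
Proof.
move=> a z1 z2; rewrite /next_z zx_linear zu_linear zr_linear rshiftrefP.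
have -> : A *m (a *: zx z1 + zx z2) + B *m (a *: zu z1 + zu z2) =
          a *: (A *m zx z1 + B *m zu z1) + (A *m zx z2 + B *m zu z2).
  by rewrite !mulmxDr -!scalemxAr scalerDr addrACA.
by rewrite yvecP mulmxDr -scalemxAr zvecP.
Qed.

Lemma bellman_mx_qform S z :
  2^-1 * qform (bellman_mx S) z =
  cost Q Rw (zx z) (zu z) (row 0 (zr z))^T + gamma * (2^-1 * qform S (next_z S z)).
Proof.
rewrite !qformDl qformZl -!qform_mulmx !mul_colmx //.
- by rewrite /cost /track_err; ring.
- exact: next_z_linear.
- exact: zu_linear.
- exact: track_err_linear.
Qed.

Lemma bellman_mx_sym S : Q^T = Q -> Rw^T = Rw -> S^T = S ->
  (bellman_mx S)^T = bellman_mx S.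
Proof.
by move=> sQ sR sS; rewrite !linearD !linearZ /= !trmx_mul !trmxK sQ sR sS !mulmxA.
Qed.

Local Notation e_ p := (delta_mx p 0 : 'cV[R]_zd).

Lemma delta_blk (p q : 'I_zd) : blk q != blk p -> e_ p q 0 = 0.
Proof. by rewrite mxE eqxx andbT; case: (q =P p) => [->|]; rewrite ?eqxx. Qed.

Lemma zx_delta p : blk p != 0%N -> zx (e_ p) = 0.
Proof.
move=> bp; apply/matrixP => b c.
by rewrite (ord1 c) zxE delta_blk ?mxE // blk_ix eq_sym.
Qed.

Lemma zu_delta p : blk p != 1%N -> zu (e_ p) = 0.
Proof.
move=> bp; apply/matrixP => a c.
by rewrite (ord1 c) zuE delta_blk ?mxE // blk_iu eq_sym.
Qed.

Lemma zr_delta_row p (i : 'I_N.+1) : blk p != i.+2 -> row i (zr (e_ p)) = 0.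
Proof.
move=> bp; apply/matrixP => c j.
by rewrite [LHS]mxE zrE delta_blk ?mxE // blk_ir eq_sym.
Qed.

Lemma track_err_delta p : blk p != 0%N -> blk p != 2 -> track_err (e_ p) = 0.
Proof.
by move=> bp0 bp2; rewrite /track_err zx_delta // zr_delta_row // trmx0 subr0.
Qed.

Lemma next_z_delta S p : blk p = 2 -> next_z S (e_ p) = 0.
Proof.
move=> bp; rewrite /next_z; have -> : rshiftref (zr (e_ p)) = 0.
  apply/matrixP => i j; rewrite [LHS]mxE [RHS]mxE; case: ifP => // iN.
  have : row (inord i.+1) (zr (e_ p)) = 0 by apply: zr_delta_row; rewrite bp inordK.
  by move/matrixP/(_ 0 j); rewrite !mxE.
by rewrite zx_delta ?zu_delta ?bp // !mulmx0 addr0 yvec0 mulmx0 zvec0.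
Qed.

Lemma zero_blk_cases a b : zero_blk a b ->
  a = 2 /\ b != 0%N /\ b != 2 \/ b = 2 /\ a != 0%N /\ a != 2.
Proof. by case: a b => [|[|[|a]]] [|[|[|b]]]; rewrite /zero_blk //=; auto. Qed.

Lemma bellman_mx_structured S : structured (bellman_mx S).
Proof.
move=> p q /zero_blk_cases zpq.
have [kE kU kN] : [/\ track_err (e_ p) = 0 \/ track_err (e_ q) = 0,
    zu (e_ p) = 0 \/ zu (e_ q) = 0 & next_z S (e_ p) = 0 \/ next_z S (e_ q) = 0].
  case: zpq => -[b2 [b0 b2']]; split.
  - by right; exact: track_err_delta.
  - by left; rewrite zu_delta // b2.
  - by left; exact: next_z_delta.
  - by left; exact: track_err_delta.
  - by right; rewrite zu_delta // b2.
  - by right; exact: next_z_delta.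
rewrite !addmxE scalemxE (colmx_sandwich Q track_err_linear kE).
rewrite (colmx_sandwich Rw (@zu_linear _ _ _ _) kU).
by rewrite (colmx_sandwich S (next_z_linear S) kN) mulr0 !addr0.
Qed.

End bellman_matrix.

Section policy_evaluation.
Variables (R : realType) (n m N Ms : nat).
Variables (A : 'M[R]_n) (B : 'M[R]_(n, m)) (Q : 'M[R]_n) (Rw : 'M[R]_m) (gamma : R).
Variables (x : nat -> 'cV[R]_n) (u : nat -> 'cV[R]_m) (r : nat -> 'cV[R]_n).
Hypothesis dyn : forall j, (j < Ms)%N -> x j.+1 = A *m x j + B *m u j.
Hypothesis gram_unit : (Phi N Ms x u r)^T *m Phi N Ms x u r \in unitmx.
Hypotheses (sQ : Q^T = Q) (sR : Rw^T = Rw).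
Local Notation w := (w_iter N Ms Q Rw gamma x u r).
Local Notation bellman := (bellman_mx A B Q Rw gamma).

Lemma refs_at_succ j : refs_at N r j j.+1 = rshiftref (refs_at N r j j).
Proof.
apply/matrixP => i c; rewrite !mxE; case: ltnP => iN; last first.
  by rewrite ifF //; apply/negbTE; rewrite -ltnNge addSn ltnS leq_add2l.
by rewrite inordK ?ltnS // addSnnS; case: leqP.
Qed.

Lemma refs_at_row0 j : (row 0 (refs_at N r j j))^T = r j.
Proof. by apply/matrixP => b c; rewrite (ord1 c) !mxE addn0 leq_addr. Qed.

Lemma zstar_next_z S j : (j < Ms)%N ->
  zstar x r (gain S) j = next_z A B S (zsample N x u r j).
Proof.
by move=> jMs; rewrite /zstar /next_z zx_zvec zu_zvec zr_zvec -refs_at_succ -dyn.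
Qed.

Lemma bellman_Hof_sym (v : 'cV[R]_(nL n m N)) : (bellman (Hof v))^T = bellman (Hof v).
Proof. by apply: bellman_mx_sym; rewrite ?Hof_sym. Qed.

Lemma vi_step_bellman (v : 'cV[R]_(nL n m N)) :
  vi_step Ms Q Rw gamma x u r v = vmap (bellman (Hof v)).
Proof.
rewrite /vi_step /=; set target := \col_(j < Ms) _.
suff -> : target = Phi N Ms x u r *m vmap (bellman (Hof v)) by exact: mulmx_lsq_exact.
apply/matrixP => j c; rewrite (ord1 c) mxE Hof_phi zstar_next_z //.
transitivity (2^-1 * qform (bellman (Hof v)) (zsample N x u r j)).
  by rewrite bellman_mx_qform zx_zvec zu_zvec zr_zvec refs_at_row0.
rewrite -vmap_phi ?bellman_Hof_sym //; last exact: bellman_mx_structured.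
rewrite [LHS]mxE [RHS]mxE.
by apply: eq_bigr => k _; rewrite !mxE mulrC.
Qed.

Lemma Hof_w_iter_succ i : Hof (w i.+1) = bellman (Hof (w i)).
Proof.
rewrite /= vi_step_bellman Hof_vmap ?bellman_Hof_sym //.
exact: bellman_mx_structured.
Qed.

End policy_evaluation.

Section greedy_gain.
Variables (R : realType) (n m N : nat).
Local Notation zd := (zdim n m N).
Local Notation ix := (@ix n m N).
Local Notation iu := (@iu n m N).
Local Notation ir := (@ir n m N).
Implicit Types (S : 'M[R]_zd) (x : 'cV[R]_n) (v : 'cV[R]_m) (rs : 'M[R]_(N.+1, n)).

Lemma gainE S : gain S = - (invmx (huu S) *m huy S).
Proof.
rewrite /gain; case: eqP => [->|//].
rewrite (_ : huy 0 = 0) ?mulmx0 ?oppr0 //; apply/matrixP => a c.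
by rewrite !mxE; case: (fintype.split c) => ?; rewrite mxE.
Qed.

Lemma sum_zdim_u (F : 'I_zd -> R) :
  (forall b, F (ix b) = 0) -> (forall i j, F (ir i j) = 0) ->
  \sum_p F p = \sum_a F (iu a).
Proof.
move=> Fx Fr; rewrite sum_zdim big1 // add0r.
by rewrite [X in _ + X]big1 ?addr0 // => i _; rewrite big1.
Qed.

Lemma qform_zvec_u S v : qform S (zvec 0 v 0) = qform (huu S) v.
Proof.
rewrite !qformE sum_zdim_u => [|b|i j]; last 2 first.
- by rewrite zvec_ix mx0E big1 // => q _; rewrite !mul0r.
- by rewrite zvec_ir mx0E big1 // => q _; rewrite !mul0r.
apply: eq_bigr => a _; rewrite sum_zdim_u => [|b|i j]; last 2 first.
- by rewrite zvec_ix mx0E mulr0.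
- by rewrite zvec_ir mx0E mulr0.
by apply: eq_bigr => b _; rewrite !zvec_iu [in RHS]mxE.
Qed.

Lemma bilin_zvec_u S v x rs : (forall a j, S (iu a) (ir ord0 j) = 0) ->
  ((zvec 0 v 0)^T *m S *m zvec x 0 rs) 0 0 = (v^T *m (huy S *m yvec x rs)) 0 0.
Proof.
move=> S_ur0; rewrite bilinE sum_zdim_u => [|b|i j]; last 2 first.
- by rewrite zvec_ix mx0E big1 // => q _; rewrite !mul0r.
- by rewrite zvec_ir mx0E big1 // => q _; rewrite !mul0r.
rewrite mxE; apply: eq_bigr => a _; rewrite zvec_iu [v^T 0 a]mxE.
under eq_bigr do rewrite -mulrA.
rewrite -mulr_sumr [in RHS]mxE; congr (_ * _); rewrite [LHS]sum_zdim [RHS]sum_ydim.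
have -> : \sum_a' S (iu a) (iu a') * zvec x 0 rs (iu a') 0 = 0.
  by apply: big1 => a' _; rewrite zvec_iu mx0E mulr0.
rewrite add0r big_ord_recl.
have -> : \sum_j S (iu a) (ir ord0 j) * zvec x 0 rs (ir ord0 j) 0 = 0.
  by apply: big1 => j _; rewrite S_ur0 mul0r.
rewrite add0r; apply: (f_equal2 +%R).
  by apply: eq_bigr => b _; rewrite zvec_ix huy_lshift yvec_lshift.
by apply: eq_bigr => i _; apply: eq_bigr => j _; rewrite zvec_ir huy_rshift yvec_rshift.
Qed.

Lemma qform_zvec_split S x v rs : S^T = S -> structured S ->
  qform S (zvec x v rs) =
  qform S (zvec x 0 rs) + 2 * (v^T *m (huy S *m yvec x rs)) 0 0 + qform (huu S) v.
Proof.
move=> sS stS; have S_ur0 a j : S (iu a) (ir ord0 j) = 0.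
  by apply: stS; rewrite blk_iu blk_ir.
by rewrite zvec_split qformDr // bilin_zvec_u // qform_zvec_u.
Qed.

Lemma gain_min S x v rs : S^T = S -> structured S ->
  (forall v, v != 0 -> 0 < qform (huu S) v) ->
  qform S (zvec x (gain S *m yvec x rs) rs) <= qform S (zvec x v rs).
Proof.
move=> sS stS pdU; rewrite qform_zvec_split // [leRHS]qform_zvec_split // -!addrA lerD2l.
apply: qform_min_affine.
- by apply/matrixP => a b; rewrite !mxE -[in LHS]sS mxE.
- exact: pos_qform_ge0.
- by rewrite gainE mulNmx mulmxN -mulmxA mulmxA mulmxV ?mul1mx // posdef_unitmx.
Qed.

End greedy_gain.

Lemma inf_range_min (R : realType) (T : Type) (f : T -> R) t0 :
  (forall t, f t0 <= f t) -> inf (range f) = f t0.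
Proof.
move=> f_min; have lb_f : lbound (range f) (f t0) by move=> _ [t _ <-].
apply/eqP; rewrite eq_le ge_inf ?lb_le_inf //=; first by exists (f t0), t0.
  by exists (f t0).
by exists t0.
Qed.

Section finite_horizon.
Variables (R : realType) (n m N Ms : nat).
Variables (A : 'M[R]_n) (B : 'M[R]_(n, m)) (Q : 'M[R]_n) (Rw : 'M[R]_m) (gamma : R).
Variables (x : nat -> 'cV[R]_n) (u : nat -> 'cV[R]_m) (r : nat -> 'cV[R]_n).
Hypotheses (pdR : posdef Rw) (psdQ : possemidef Q) (gamma_ge0 : 0 <= gamma).
Hypothesis dyn : forall j, (j < Ms)%N -> x j.+1 = A *m x j + B *m u j.
Hypothesis gram_unit : (Phi N Ms x u r)^T *m Phi N Ms x u r \in unitmx.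
Local Notation w := (w_iter N Ms Q Rw gamma x u r).
Local Notation Qfin := (@Qfin R n m N A B Q Rw gamma).
Local Notation zd := (zdim n m N).

Lemma cost_ge0 x0 u0 r0 : 0 <= cost Q Rw x0 u0 r0.
Proof.
rewrite mulr_ge0 ?invr_ge0 ?ler0n // addr_ge0 //; first exact: psdQ.2.
exact: pos_qform_ge0 pdR.2 _.
Qed.

Lemma cost_u v : cost Q Rw 0 v (row 0 (0 : 'M[R]_(N.+1, n)))^T = 2^-1 * qform Rw v.
Proof.
have -> : row 0 (0 : 'M[R]_(N.+1, n)) = 0 by apply/matrixP => i j; rewrite !mxE.
by rewrite /cost trmx0 subr0 qform0r add0r.
Qed.

Lemma Qfin_ge_cost K x0 u0 rs : cost Q Rw x0 u0 (row 0 rs)^T <= Qfin K x0 u0 rs.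
Proof.
elim: K x0 u0 rs => [//|K IH] x0 u0 rs /=; rewrite lerDl mulr_ge0 //.
apply: lb_le_inf => [|_ [u' _ <-]]; first by eexists; exists 0.
exact: le_trans (cost_ge0 _ _ _) (IH _ _ _).
Qed.

Lemma huu_posdef (S : 'M[R]_zd) :
  (forall v, 2^-1 * qform Rw v <= 2^-1 * qform S (zvec 0 v 0)) ->
  forall v, v != 0 -> 0 < qform (huu S) v.
Proof.
move=> RS v v0; rewrite -qform_zvec_u.
by have := pdR.2 v v0; have := RS v; lra.
Qed.

Lemma Qfin_w_iter K x0 u0 rs :
  Qfin K x0 u0 rs = 2^-1 * qform (Hof (w K.+1)) (zvec x0 u0 rs).
Proof.
have [sQ sR] := (psdQ.1, pdR.1).
elim: K x0 u0 rs => [|K IH] x0 u0 rs.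
  rewrite (Hof_w_iter_succ gamma dyn gram_unit sQ sR) /= bellman_mx_qform.
  by rewrite Hof0 qform0l !mulr0 addr0 zx_zvec zu_zvec zr_zvec.
rewrite [LHS]/= (Hof_w_iter_succ gamma dyn gram_unit sQ sR) bellman_mx_qform.
rewrite zx_zvec zu_zvec zr_zvec /next_z zx_zvec zu_zvec zr_zvec.
have -> : (fun u' => Qfin K (A *m x0 + B *m u0) u' (rshiftref rs)) =
          (fun u' => 2^-1 * qform (Hof (w K.+1)) (zvec (A *m x0 + B *m u0) u' (rshiftref rs))).
  by apply/funext => u'; rewrite IH.
rewrite (@inf_range_min _ _ _ (gain (Hof (w K.+1)) *m yvec (A *m x0 + B *m u0) (rshiftref rs))) //.
(* [Q_K >= cost] makes [h_uu] positive definite, so the greedy input is optimal. *)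
move=> u'; rewrite ler_pM2l ?invr_gt0 ?ltr0n //.
apply: gain_min; [exact: Hof_sym | exact: Hof_structured |].
by apply: huu_posdef => v; rewrite -IH -cost_u; exact: Qfin_ge_cost.
Qed.

End finite_horizon.

Section convergence.
Variables (R : realType) (n m N : nat) (T : Type) (F : set_system T).
Context {FF : Filter F}.
Local Notation zd := (zdim n m N).

Lemma cvg_vmap (f : T -> 'M[R]_zd) (G : 'M[R]_zd) :
  f @ F --> G -> vmap (f t) @[t --> F] --> vmap G.
Proof.
move/cvg_mxP => fG; apply/cvg_mxP => k c.
by under eq_cvg do rewrite mxE; rewrite mxE; exact: fG.
Qed.

Lemma cvg_gain (f : T -> 'M[R]_zd) (G : 'M[R]_zd) :
  huu G \in unitmx -> f @ F --> G -> gain (f t) @[t --> F] --> gain G.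
Proof.
move=> uG fG; under eq_cvg do rewrite gainE; rewrite gainE.
move/cvg_mxP: fG => fG; apply: cvgN; apply: cvg_mulmx; first apply: cvg_invmx => //.
  by apply/cvg_mxP => a b; under eq_cvg do rewrite mxE; rewrite mxE; exact: fG.
apply/cvg_mxP => a c; under eq_cvg do rewrite mxE; rewrite mxE.
by case: (fintype.split c) => *; exact: fG.
Qed.

End convergence.

Theorem theorem2 (R : realType) (n m N Ms : nat)
  (A : 'M[R]_n) (B : 'M[R]_(n, m)) (Q : 'M[R]_n) (Rw : 'M[R]_m) (gamma : R)
  (H : 'M[R]_(zdim n m N))
  (x : nat -> 'cV[R]_n) (u : nat -> 'cV[R]_m) (r : nat -> 'cV[R]_n) :
  posdef Rw -> possemidef Q -> controllable A B ->
  0 <= gamma -> gamma < 1 ->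
  (* H is the matrix of the reference-dependent Q-function Q_0 = lim_K ^K Q_0 *)
  H^T = H ->
  (forall (x0 : 'cV[R]_n) (u0 : 'cV[R]_m) (rs : 'M[R]_(N.+1, n)),
     (fun K => Qfin A B Q Rw gamma K x0 u0 rs) @ \oo -->
       (2^-1 * qform H (zvec x0 u0 rs) : R)) ->
  (* data generated by the system *)
  (forall j, (j < Ms)%N -> x j.+1 = A *m x j + B *m u j) ->
  (nL n m N <= Ms)%N ->
  \rank ((Phi N Ms x u r)^T *m Phi N Ms x u r) = nL n m N ->
  let w := w_iter N Ms Q Rw gamma x u r in
  [/\ (fun i => Hof (w i)) @ \oo --> H,
      (fun i => w i) @ \oo --> vmap H &
      (fun i => gain (Hof (w i))) @ \oo --> gain H].
Proof.
(* Controllability and [gamma < 1] only serve to make the limit [H] exist,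
   which is assumed here; [nL <= Ms] follows from the rank condition. *)
move=> pdR psdQ _ gamma_ge0 _ sH Qlim dyn _ rank_gram w.
have gram_unit : (Phi N Ms x u r)^T *m Phi N Ms x u r \in unitmx.
  by rewrite -row_free_unit /row_free rank_gram.
have Qfin_w := Qfin_w_iter pdR psdQ gamma_ge0 dyn gram_unit.
have qform_cvg z : qform (Hof (w t.+1)) z @[t --> \oo] --> qform H z.
  have two_neq0 : 2 != 0 :> R by rewrite pnatr_eq0.
  have /(cvgMl_tmp (a := 2)) := Qlim (zx z) (zu z) (zr z).
  by under eq_cvg do rewrite Qfin_w mulVKf // zvecK; rewrite mulVKf // zvecK.
have HwH : (fun i => Hof (w i)) @ \oo --> H.
  by rewrite -cvg_shiftS; apply: cvg_mx_of_qform qform_cvg => // t; exact: Hof_sym.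
have uH : huu H \in unitmx.
  apply/posdef_unitmx/(huu_posdef pdR) => v.
  apply: (ler_cvg_to (cvg_cst _) (Qlim 0 v 0)); apply: nearW => K.
  by rewrite -(cost_u N Q); exact: Qfin_ge_cost.
split => //; last exact: cvg_gain.
by under eq_cvg do rewrite -[w _]vmap_Hof; exact: cvg_vmap.
Qed.
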